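(* Let $m_1,m_2,m_3,m_4$ be positive integers and let $A,B,C\in\mathbb{C}$ be nonzero with $B/A\notin\mathbb{R}$, $BC(B-C)=m_2m_3$, $CA(C-A)=m_1m_4$, and $AB(A-B)=m_1m_2$. Define $f(x,y)=(m_2Ax+m_1By)^2/A$. Then for all integers $n_1,n_2,d$, \[m_2m_3f(n_1+m_1d,n_2)+m_1m_4f(n_1,n_2+m_2d)+m_1m_2f(n_1-m_3d,n_2-m_4d)=(m_2m_3+m_1m_4+m_1m_2)f(n_1,n_2).\] *)

(* Defs.v *)
From HB Require Import structures.
From mathcomp Require Export all_boot all_order all_algebra.
From mathcomp Require Export reals complex.

Set Implicit Arguments.
Unset Strict Implicit.
Unset Printing Implicit Defensive.

Import Order.TTheory GRing.Theory Num.Theory.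
Local Open Scope ring_scope.
Local Open Scope complex_scope.

Definition quad_form (R : realType) (m1 m2 : int) (A B : R[i]) (x y : int) : R[i] :=
  (m2%:~R * A * x%:~R + m1%:~R * B * y%:~R) ^+ 2 / A.

(* Main.v *)
Require Import Defs.
From mathcomp Require Import ring.
Import Order.TTheory GRing.Theory Num.Theory.
Local Open Scope ring_scope.
Local Open Scope complex_scope.

(* With w1 = BC(B-C) = m2 m3, w2 = CA(C-A) = m1 m4, w3 = AB(A-B) = m1 m2 and
   L = m2 A n1 + m1 B n2, the three shifts replace L by L + w3 A d, L + w3 B d
   and L + w3 C d; the last one because w1 A + w2 B = ABC(B-A) = - w3 C.  The
   terms linear and quadratic in d then cancel, since w1 A + w2 B + w3 C = 0
   and w1 A^2 + w2 B^2 + w3 C^2 = 0. *)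
Lemma weighted_sqr_sum (K : comPzRingType) (A B C L t : K) :
  B * C * (B - C) * (L + A * t) ^+ 2 + C * A * (C - A) * (L + B * t) ^+ 2
    + A * B * (A - B) * (L + C * t) ^+ 2
  = (B * C * (B - C) + C * A * (C - A) + A * B * (A - B)) * L ^+ 2.
Proof. by ring. Qed.

Theorem lemma4p3 (R : realType) (m1 m2 m3 m4 : int) (A B C : R[i])
    (m1_gt0 : 0 < m1) (m2_gt0 : 0 < m2) (m3_gt0 : 0 < m3) (m4_gt0 : 0 < m4)
    (A_neq0 : A != 0) (B_neq0 : B != 0) (C_neq0 : C != 0)
    (BA_nonreal : B / A \isn't Num.real)
    (hBC : B * C * (B - C) = (m2 * m3)%:~R)
    (hCA : C * A * (C - A) = (m1 * m4)%:~R)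
    (hAB : A * B * (A - B) = (m1 * m2)%:~R) :
  let f := quad_form m1 m2 A B in
  forall n1 n2 d : int,
    (m2 * m3)%:~R * f (n1 + m1 * d) n2
    + (m1 * m4)%:~R * f n1 (n2 + m2 * d)
    + (m1 * m2)%:~R * f (n1 - m3 * d) (n2 - m4 * d)
    = (m2 * m3 + m1 * m4 + m1 * m2)%:~R * f n1 n2.
Proof.
(* All four terms end in the factor [A^-1]; pulling it out leaves an identity between weighted
   squares of linear forms. *)
move=> f n1 n2 d; rewrite /f /quad_form !(mulrA _ _ A^-1) -!mulrDl.
congr (_ / A).
set L := m2%:~R * A * n1%:~R + m1%:~R * B * n2%:~R.
(* Shifting [n1] by [m1 * d] adds [m2 A m1 d], and shifting [n2] by [m2 * d] adds [m1 B m2 d]: both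
   share this factor. *)
set t : R[i] := (m1 * m2)%:~R * d%:~R.
have shift1 : m2%:~R * A * (n1 + m1 * d)%:~R + m1%:~R * B * n2%:~R = L + A * t.
  by rewrite /L /t; ring.
have shift2 : m2%:~R * A * n1%:~R + m1%:~R * B * (n2 + m2 * d)%:~R = L + B * t.
  by rewrite /L /t; ring.
have shift3 : m2%:~R * A * (n1 - m3 * d)%:~R + m1%:~R * B * (n2 - m4 * d)%:~R
    = L + C * t.
  (* This grouping exposes the products [m2 * m3] and [m1 * m4], which the hypotheses turn into
     polynomials in [A], [B], [C]. *)
  transitivity (L - (A * (m2 * m3)%:~R + B * (m1 * m4)%:~R) * d%:~R).
    by rewrite /L; ring.
  by rewrite /t -hBC -hCA -hAB; ring.
by rewrite shift1 shift2 shift3 !intrD -hBC -hCA -hAB weighted_sqr_sum.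
Qed.
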